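(* Let $G$ be a graph with vertex set $[n]$ and clique number $\omega=\omega(G)$, let $1\le s<\omega$, and let $\mathbf{x}=(x_1,\ldots,x_n)\in\mathbb{R}^n$ with $\mathbf{x}>0$. Let $$R_s=\{v\in V(G): v \text{ is contained in some } s\text{-clique of } G\}.$$ Then the equality $$\rho_{s+1}(G,\mathbf{x})^{1/(s+1)}=\rho_s(G,\mathbf{x})^{1/s}$$ holds if and only if the induced subgraph $G[R_s]$ is a complete $\omega$-partite graph and, if $V_1,\ldots,V_\omega$ are the vertex classes of $G[R_s]$, then $\sum_{v\in V_i}x_v=\sum_{v\in V_j}x_v$ for all $1\le i<j\le\omega$.
   Context: Graphs are finite, simple and undirected, with vertex set $[n]=\{1,\ldots,n\}$, $n\ge 1$. An $s$-clique of $G$ is a set of $s$ pairwise adjacent vertices; $K_s(G)$ denotes the set of $s$-cliques of $G$, and $\omega(G)$ is the size of a largest clique of $G$. For $\mathbf{x}=(x_1,\ldots,x_n)\in\mathbb{R}^n$ and $1\le s\le\omega=\omega(G)$, define $$f_s(G,\mathbf{x})=\sum_{\{i_1,\ldots,i_s\}\in K_s(G)}x_{i_1}\cdots x_{i_s},\qquad \rho_s(G,\mathbf{x})=f_s(G,\mathbf{x})\binom{\omega}{s}^{-1}.$$ The notation $\mathbf{x}>0$ means that all coordinates of $\mathbf{x}$ are positive. A graph is complete $\omega$-partite if its vertex set can be partitioned into $\omega$ nonempty classes such that two vertices are adjacent exactly when they lie in different classes. *)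

(* Defs.v *)
From HB Require Import structures.
From mathcomp Require Import all_boot all_order all_algebra.
From mathcomp Require Import reals.

Set Implicit Arguments.
Unset Strict Implicit.
Unset Printing Implicit Defensive.

Import Order.TTheory GRing.Theory Num.Theory.
Local Open Scope ring_scope.

Record sgraph (V : finType) := SGraph {
  adj : rel V;
  adj_sym : symmetric adj;
  adj_irrefl : irreflexive adj
}.

Section Graphs.
Variables (V : finType) (G : sgraph V).

Definition is_clique (A : {set V}) : bool :=
  [forall u in A, forall v in A, (u != v) ==> adj G u v].

Definition cliques (s : nat) : {set {set V}} :=
  [set A : {set V} | is_clique A && (#|A| == s)].

Definition clique_number : nat := \max_(A : {set V} | is_clique A) #|A|.

Definition clique_vertices (s : nat) : {set V} :=
  [set v | [exists A in cliques s, v \in A]].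

Definition induced (S : {set V}) : sgraph {v : V | v \in S} :=
  SGraph (fun u v : {v : V | v \in S} => adj_sym G (val u) (val v))
         (fun u : {v : V | v \in S} => adj_irrefl G (val u)).

(* [partition] already requires the classes to be nonempty. *)
Definition multipartite_classes (k : nat) (P : {set {set V}}) : Prop :=
  [/\ partition P [set: V], #|P| = k &
      forall u v : V, adj G u v <-> pblock P u <> pblock P v].

Definition complete_multipartite (k : nat) : Prop :=
  exists P : {set {set V}}, multipartite_classes k P.

End Graphs.

Section CliquePolynomials.
Variables (R : realType) (n : nat) (G : sgraph 'I_n).

Definition clique_poly (s : nat) (x : 'rV[R]_n) : R :=
  \sum_(A in cliques G s) \prod_(i in A) x ord0 i.

Definition clique_density (s : nat) (x : 'rV[R]_n) : R :=
  clique_poly s x / 'C(clique_number G, s)%:R.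

End CliquePolynomials.

(* Main.v *)
Require Import Defs.
From mathcomp Require Import all_boot all_order all_algebra.
From mathcomp Require Import reals exp.
From mathcomp Require Import zify ring.
Import Order.TTheory GRing.Theory Num.Theory.
Local Open Scope ring_scope.

(** Write [f_s] for the sum, over the [s]-cliques inside a vertex set [S], of
the products of their weights, and [rho_s] for [f_s] divided by 'C(w, s),
where [w] bounds the size of all cliques. The proof rests on moving weight
between two non-adjacent vertices [u] and [v].

No clique contains both [u] and [v], so [f_s = c + a_u x_u + a_v x_v], where
[a_u] is [f_(s-1)] of the neighbourhood of [u] in [S], and likewise
[f_(s+1) = d + b_u x_u + b_v x_v]; the six coefficients do not involve [x_u]
and [x_v]. Deleting [u] and adding [x_u a_u / a_v] to [x_v] leaves [f_s]
unchanged and changes [f_(s+1)] by [x_u (a_u b_v / a_v - b_u)]. Either this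
operation or the one with [u] and [v] exchanged does not decrease [f_(s+1)].
If [a_u = 0], no [s]-clique contains [u], and [u] is deleted outright.
Repeating these steps until a clique is left reduces the inequality
[rho_(s+1)^s <= rho_s^(s+1)] ([dens_maclaurin]) to Maclaurin's inequality for
the weights of that clique, padded by zeros to [w] numbers ([maclaurin],
deduced from Newton's inequalities).

Suppose that equality holds ([tight]) and that all vertices of [S] lie in
[s]-cliques of [S] ([covered]). If one of the two operations increased
[f_(s+1)], the inequality would fail for the smaller vertex set; hence
[b_u / a_u = b_v / a_v], and both operations preserve equality ([tight_pour]).
Both hypotheses are thus inherited by [S] minus any vertex that has a
non-neighbour. If non-adjacency failed to be transitive on [S], with [v]
non-adjacent to [u] and [t] but [u] adjacent to [t], deleting further vertices
in this way would lead to the case where [S] minus [v] is a clique. Moving the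
weight of [v] to [u] gives a clique with equality, all of whose weights must
agree by the equality case of Maclaurin, so [x_u < x_t]; moving it to [t]
instead gives [x_t < x_u], a contradiction ([tight_nonadj_trans]).

So [S] is complete multipartite. Two vertices of one class have the same
neighbours, so the operation becomes the addition of their weights, and merging
each class to one vertex shows that equality holds exactly when Maclaurin's
inequality is an equality for the class sums ([tight_multipartite]). The
theorem follows by taking for [S] the set of vertices of [s]-cliques; it
contains every maximum clique, since [s < w]. *)

(** * Newton's and Maclaurin's inequalities *)

Section Maclaurin.
Set Implicit Arguments.
Unset Strict Implicit.
Variable R : realFieldType.
Implicit Types (l : seq R) (y : R) (k : nat).

Fixpoint esym l k : R :=
  match l, k with
  | _, 0%N => 1
  | [::], _.+1 => 0
  | y :: l', k'.+1 => esym l' k'.+1 + y * esym l' k'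
  end.

(** The elementary symmetric polynomial divided by the number of its monomials
([esym_meanE]). It is given by its own recursion on the list, because the
induction step of Newton's inequality compares the coefficients of this
recursion; with the truncated subtraction it vanishes for [k > size l]. *)
Fixpoint esym_mean l k : R :=
  if l is y :: l' then
    (((size l').+1 - k)%:R * esym_mean l' k
     + k%:R * y * esym_mean l' k.-1) / (size l').+1%:R
  else (k == 0%N)%:R.

Lemma esym0 l : esym l 0 = 1. Proof. by case: l. Qed.

Lemma esym_nseq0 m k : esym (nseq m 0) k.+1 = 0.
Proof. by elim: m k => [|m IH] k //=; rewrite IH mul0r addr0. Qed.

Lemma esym_cat0 l m k : esym (l ++ nseq m 0) k = esym l k.
Proof.
elim: l k => [|y l IH] [|k]; rewrite ?esym0 ?cat0s ?esym_nseq0 //.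
by rewrite /= !IH.
Qed.

Lemma esym_meanE l k : esym l k = 'C(size l, k)%:R * esym_mean l k.
Proof.
elim: l k => [|y l IH] [|k] /=; rewrite ?bin0 ?mul1r ?mul0r //.
  have := IH 0%N; rewrite esym0 bin0 mul1r subn0 => <-.
  by rewrite ?mul0r addr0 mulr1 divff // pnatr_eq0.
rewrite !IH.
have n0 : (size l).+1%:R != 0 :> R by rewrite pnatr_eq0.
apply: (mulIf n0); rewrite -[RHS]mulrA divfK //.
have h1 := mul_bin_down (size l).+1 k.+1.
have h2 := mul_bin_diag (size l).+1 k.
move/(congr1 (fun n => n%:R : R)): h1; move/(congr1 (fun n => n%:R : R)): h2.
rewrite /= !natrM => h2 h1.
rewrite mulrDr !mulrA ['C(_.+1, _)%:R * _]mulrC -h1 ['C(_.+1, _)%:R * _]mulrC -h2.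
ring.
Qed.

Lemma esym_mean_gt_size l k : (size l < k)%N -> esym_mean l k = 0.
Proof.
elim: l k => [|y l IH] [|k] //= hk.
have -> : ((size l).+1 - k.+1 = 0)%N by lia.
by rewrite (IH k) //; rewrite mul0r mulr0 addr0 mul0r.
Qed.

Lemma esym_mean0 l : esym_mean l 0 = 1.
Proof. by have := esym_meanE l 0; rewrite esym0 bin0 mul1r. Qed.

Definition nonneg l := {in l, forall y, 0 <= y}.

Lemma nonneg_cons y l : nonneg (y :: l) -> 0 <= y /\ nonneg l.
Proof.
move=> h; split; first by apply: h; rewrite mem_head.
by move=> z zl; apply: h; rewrite inE zl orbT.
Qed.

Lemma esym_ge0 l k : nonneg l -> 0 <= esym l k.
Proof.
elim: l k => [|y l IH] [|k] //= /nonneg_cons[y0 l0].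
by rewrite addr_ge0 ?mulr_ge0 ?IH.
Qed.

Lemma esym_mean_ge0 l k : nonneg l -> 0 <= esym_mean l k.
Proof.
elim: l k => [|y l IH] k /= h; first by rewrite ler0n.
have [y0 l0] := nonneg_cons h.
by rewrite divr_ge0 ?addr_ge0 ?mulr_ge0 ?IH.
Qed.

Lemma esym_eq0S l k : nonneg l -> esym l k = 0 -> esym l k.+1 = 0.
Proof.
elim: l k => [|y l IH] [|k] //= h.
  by move/eqP; rewrite oner_eq0.
have [y0 l0] := nonneg_cons h.
move=> /eqP; rewrite paddr_eq0 ?mulr_ge0 ?esym_ge0 // => /andP[/eqP e1].
move=> _; by rewrite (IH _ l0 e1) e1 mulr0 addr0.
Qed.

(** Newton's inequalities alone allow a zero followed by nonzero means; ruling
this out is what lets them be chained. *)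
Lemma esym_mean_eq0S l k :
  nonneg l -> esym_mean l k = 0 -> esym_mean l k.+1 = 0.
Proof.
move=> l0 e0; have [kn|nk] := ltnP k (size l); last exact: esym_mean_gt_size.
have /eqP : esym l k.+1 = 0 by apply: esym_eq0S; rewrite // esym_meanE e0 mulr0.
by rewrite esym_meanE mulf_eq0 pnatr_eq0 eqn0Ngt bin_gt0 kn => /eqP.
Qed.

(** Here [a, b, c, d] are consecutive means of a list, [b] having index [k],
and [y] is the new entry; the size of the list is [k + m + 1].
The three hypotheses, with the right multipliers, leave the square of
[c - y b]. The factor [k] makes those about [a] void for [k = 0], where [a]
would be the mean of index -1. *)
Lemma newton_step (k m : nat) (a b c d y : R) : 0 <= y ->
    k%:R * (a * c) <= k%:R * b ^+ 2 -> b * d <= c ^+ 2 ->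
    k%:R * (a * d) <= k%:R * (b * c) ->
  (m.+2%:R * b + k%:R * y * a) * (m%:R * d + k.+2%:R * y * c) <=
  (m.+1%:R * c + k.+1%:R * y * b) ^+ 2.
Proof.
move=> y0 ac bd ad; rewrite -subr_ge0.
have -> : (m.+1%:R * c + k.+1%:R * y * b) ^+ 2 -
    (m.+2%:R * b + k%:R * y * a) * (m%:R * d + k.+2%:R * y * c) =
  (c - y * b) ^+ 2 + (m * m.+2)%:R * (c ^+ 2 - b * d)
  + m%:R * y * (k%:R * (b * c) - k%:R * (a * d))
  + k.+2%:R * y ^+ 2 * (k%:R * b ^+ 2 - k%:R * (a * c)).
  by rewrite -!natr1 natrM -!natr1; ring.
by rewrite !addr_ge0 ?sqr_ge0 // !mulr_ge0 ?subr_ge0 ?sqr_ge0.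
Qed.

(** The hypothesis on [a d] in [newton_step] is the product of two consecutive
instances of the induction hypothesis, divided by [b c]. *)
Lemma newton l k : nonneg l ->
  esym_mean l k * esym_mean l k.+2 <= esym_mean l k.+1 ^+ 2.
Proof.
elim: l k => [|y l IH] k h; first by rewrite /= mulr0 sqr_ge0.
have [y0 l0] := nonneg_cons h.
have [kn|nk] := leqP (size l).+1 k.+1.
  by rewrite (@esym_mean_gt_size _ k.+2) ?mulr0 ?sqr_ge0 //= ltnS.
rewrite /=.
have -> : ((size l).+1 - k.+2 = (size l - k.+1))%N by lia.
have -> : ((size l).+1 - k.+1 = (size l - k.+1).+1)%N by lia.
have -> : ((size l).+1 - k = (size l - k.+1).+2)%N by lia.
rewrite mulf_div exprMn exprVn -expr2 ler_pM2r; last first.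
  by rewrite invr_gt0 exprn_gt0 ?ltr0n.
apply: newton_step => //;
  first by case: k {nk} => [|k] /=; rewrite ?mul0r // ler_wpM2l ?IH.
  exact: IH.
case: k {nk} => [|k] /=; first by rewrite !mul0r.
rewrite ler_wpM2l //.
have [b0 c0] : 0 <= esym_mean l k.+1 /\ 0 <= esym_mean l k.+2.
  by split; apply: esym_mean_ge0.
have [bE|bn0] := eqVneq (esym_mean l k.+1) 0.
  have cE := esym_mean_eq0S l0 bE.
  by rewrite (esym_mean_eq0S l0 cE) cE !mulr0.
have [cE|cn0] := eqVneq (esym_mean l k.+2) 0.
  by rewrite (esym_mean_eq0S l0 cE) cE !mulr0.
have bc0 : 0 < esym_mean l k.+1 * esym_mean l k.+2.
  by rewrite mulr_gt0 ?lt_def ?bn0 ?cn0.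
rewrite -(ler_pM2r bc0) -expr2 exprMn.
have -> : forall a b c d : R, a * d * (b * c) = (a * c) * (b * d) by move=> *; ring.
by rewrite ler_pM ?mulr_ge0 ?esym_mean_ge0 ?IH.
Qed.

Lemma sum_sqr_esym l :
  \sum_(y <- l) y ^+ 2 = esym l 1 ^+ 2 - 2 * esym l 2.
Proof.
elim: l => [|y l IH]; first by rewrite big_nil /= mulr0 subr0 expr0n.
by rewrite big_cons IH /= esym0; ring.
Qed.

Lemma sum_esym l : \sum_(y <- l) y = esym l 1.
Proof.
elim: l => [|y l IH]; first by rewrite big_nil.
by rewrite big_cons IH /= esym0; ring.
Qed.

(** The case [k = 0] of [newton] with its deficit written as a variance, which
gives the equality case. *)
Lemma sum_dev_esym_mean l :
  \sum_(y <- l) (y - esym_mean l 1) ^+ 2 =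
  (size l * (size l).-1)%:R * (esym_mean l 1 ^+ 2 - esym_mean l 2).
Proof.
set p := esym_mean l 1.
under eq_bigr do rewrite sqrrB.
rewrite big_split /= sumrB sum_sqr_esym.
under [X in _ - X + _]eq_bigr do rewrite -mulr_natr -mulrA.
rewrite -mulr_suml sum_esym big_const_seq count_predT iter_addr_0.
have E1 : esym l 1 = (size l)%:R * p by rewrite esym_meanE bin1.
have E2 : 2 * esym l 2 = (size l * (size l).-1)%:R * esym_mean l 2.
  by rewrite esym_meanE mulrA -natrM -mul_bin_diag bin1.
rewrite E1 -[X in _ + X]mulr_natl E2.
case: (size l) => [|n]; first by rewrite /= !mul0r; ring.
by rewrite /= natrM -natr1; ring.
Qed.

(** Multiply by a power of the middle mean and combine Newton's inequality with
the preceding Maclaurin inequality. *)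
Lemma maclaurin l k : nonneg l ->
  esym_mean l k.+2 ^+ k.+1 <= esym_mean l k.+1 ^+ k.+2.
Proof.
move=> l0; have p0 j : 0 <= esym_mean l j by exact: esym_mean_ge0.
elim: k => [|k IH]; first by have := newton 0 l0; rewrite esym_mean0 mul1r expr1.
have [pE|pn0] := eqVneq (esym_mean l k.+2) 0.
  by rewrite (esym_mean_eq0S l0 pE) expr0n exprn_ge0.
have pp : 0 < esym_mean l k.+2 by rewrite lt_def pn0 p0.
rewrite -(ler_pM2l (exprn_gt0 k.+1 pp)) -exprD addSnnS.
have -> : (k + k.+4 = 2 * k.+2)%N by lia.
rewrite exprM; apply: le_trans (ler_wpM2r _ IH) _; first exact: exprn_ge0.
by rewrite -exprMn lerXn2r ?nnegrE ?mulr_ge0 ?exprn_ge0 ?newton.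
Qed.

(** Newton's inequality carries equality at index [k + 1] down to index [k], and
finally to the vanishing of the variance. *)
Lemma maclaurin_eq l k : nonneg l -> 0 < esym_mean l k.+1 ->
    esym_mean l k.+2 ^+ k.+1 = esym_mean l k.+1 ^+ k.+2 ->
  {in l, forall y, y = esym_mean l 1}.
Proof.
move=> l0; have p0 j : 0 <= esym_mean l j by exact: esym_mean_ge0.
elim: k => [|k IH] pp.
  rewrite expr1 => e y yl; apply/eqP; rewrite -subr_eq0 -sqrf_eq0.
  have := sum_dev_esym_mean l; rewrite e subrr mulr0 => /eqP.
  rewrite psumr_eq0 => [/allP/(_ y yl)//|z _]; exact: sqr_ge0.
move=> e; have qq : 0 < esym_mean l k.+1.
  rewrite lt_def p0 andbT; apply/eqP => /(esym_mean_eq0S l0) e0.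
  by rewrite e0 ltxx in pp.
apply: IH => //; apply/le_anti; rewrite maclaurin //=.
rewrite -(ler_pM2r (exprn_gt0 k.+3 pp)) -exprD -{1}e -exprMn.
have -> : (k.+1 + k.+3 = 2 * k.+2)%N by lia.
by rewrite exprM lerXn2r ?nnegrE ?mulr_ge0 ?exprn_ge0 ?newton.
Qed.

Lemma esym_mean_nseq n k (t : R) : (k <= n)%N -> esym_mean (nseq n t) k = t ^+ k.
Proof.
elim: n k => [|n IH] k /=; first by rewrite leqn0 => /eqP->.
rewrite size_nseq leq_eqVlt => /predU1P[->|kn].
  by rewrite subnn mul0r add0r IH //= -[_ * t * _]mulrA -exprS mulrC
    mulKf ?pnatr_eq0.
have n0 : n.+1%:R != 0 :> R by rewrite pnatr_eq0.
rewrite IH //; case: k kn => [|k] kn.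
  by rewrite !mul0r addr0 expr0 mulr1 divff.
rewrite IH 1?ltnW //= -[_ * t * _]mulrA -exprS -mulrDl -natrD subnK 1?ltnW //.
by rewrite mulrC mulKf.
Qed.
End Maclaurin.

(** * Clique sums and the transfer of weight *)

Section CliqueSums.
Set Implicit Arguments.
Unset Strict Implicit.
Variables (R : realFieldType) (V : finType) (G : sgraph V).
Implicit Types (S A B : {set V}) (u v : V) (x : V -> R) (k : nat).

Definition nbh u : {set V} := [set v | adj G u v].

Definition csum k S x : R :=
  \sum_(A in cliques G k | A \subset S) \prod_(i in A) x i.

Lemma cliqueP A :
  reflect {in A &, forall u v, u != v -> adj G u v} (is_clique G A).
Proof.
apply: (iffP forall_inP) => [h u v uA vA uv | h u uA].
  by have /forall_inP/(_ v vA) := h u uA; rewrite uv.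
by apply/forall_inP => v vA; apply/implyP; apply: h.
Qed.

Lemma cliqueS A B : A \subset B -> is_clique G B -> is_clique G A.
Proof.
move=> /subsetP AB /cliqueP h; apply/cliqueP => u v /AB uB /AB; exact: h.
Qed.

Lemma cliqueU1 u B : u \notin B ->
  is_clique G (u |: B) = is_clique G B && (B \subset nbh u).
Proof.
move=> uB; apply/cliqueP/andP => [h|[/cliqueP h /subsetP Bu] v w].
  split; first by apply/cliqueP => v w vB wB; apply: h; rewrite inE ?vB ?wB orbT.
  apply/subsetP => v vB; rewrite inE; apply: h; rewrite ?inE ?eqxx ?vB ?orbT //.
  by apply: contraNneq uB => ->.
rewrite !inE => /predU1P[->|vB] /predU1P[->|wB] vw.
- by rewrite eqxx in vw.
- by have := Bu _ wB; rewrite inE.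
- by have := Bu _ vB; rewrite inE adj_sym.
- exact: h.
Qed.

Lemma csum_ext k S x y : {in S, x =1 y} -> csum k S x = csum k S y.
Proof.
move=> xy; apply: eq_bigr => A /andP[_ /subsetP AS].
by apply: eq_bigr => i iA; apply/xy/AS.
Qed.

Lemma csum0 S x : csum 0 S x = 1.
Proof.
rewrite /csum (big_pred1 set0) ?big_set0 // => A /=.
rewrite inE cards_eq0; apply/andP/eqP => [[/andP[_ /eqP//]]|->].
rewrite eqxx andbT sub0set; split=> //; apply/cliqueP => u v; by rewrite inE.
Qed.

(** Cliques containing [u] are [u] added to the cliques of its neighbourhood, so
the last factor is the derivative of the clique sum in the variable [x u]. *)
Lemma csumD1 k S x u : u \in S ->
  csum k.+1 S x = csum k.+1 (S :\ u) x + x u * csum k (S :&: nbh u) x.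
Proof.
move=> uS; rewrite /csum (bigID [pred A : {set V} | u \notin A]) /=; congr (_ + _).
  by apply: eq_bigl => A; rewrite subsetD1 andbA.
rewrite (reindex_onto (fun B => u |: B) (fun A => A :\ u)) /=; last first.
  by move=> A /andP[_ /negPn uA]; rewrite setD1K.
rewrite mulr_sumr; apply: eq_big => [B|B].
  rewrite setU11 /= andbT; have [uB|uB] := boolP (u \in B).
    have -> : ((u |: B) :\ u == B) = false.
      by apply/negP => /eqP e; move: uB; rewrite -e !inE eqxx.
    rewrite andbF; apply/Logic.eq_sym/negP => /andP[_ /subsetP/(_ u uB)].
    by rewrite !inE adj_irrefl andbF.
  rewrite setU1K // eqxx andbT !inE cardsU1 uB cliqueU1 // subUset sub1set uS.
  by rewrite subsetI eqSS /= -!andbA; do !bool_congr.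
move=> /andP[_ /eqP e]; have uB : u \notin B by rewrite -e !inE eqxx.
by rewrite big_setU1.
Qed.

Section Positive.
Variable x : V -> R.
Hypothesis x0 : forall v, 0 < x v.

Lemma csum_ge0 k S : 0 <= csum k S x.
Proof. by apply: sumr_ge0 => A _; apply: prodr_ge0 => i _; exact: ltW. Qed.

Lemma csum_gt0P k S :
  reflect (exists2 A, is_clique G A & #|A| = k /\ A \subset S) (0 < csum k S x).
Proof.
have p0 (A : {set V}) : 0 < \prod_(i in A) x i by apply: prodr_gt0.
apply: (iffP idP) => [|[A cA [kA AS]]].
  rewrite lt_def psumr_eq0 => [/andP[/allPn[A _]]|A _]; last exact: ltW.
  rewrite negb_imply inE => /andP[/andP[/andP[cA /eqP kA] AS] _] _.
  by exists A.
rewrite /csum (bigD1 A) /= ?inE ?cA ?kA ?eqxx //.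
by rewrite ltr_wpDr ?p0 // sumr_ge0 // => B _; exact: ltW.
Qed.

(** Dropping one vertex from a clique, chosen so as to avoid [y], is always
possible without leaving [S :\ y]. *)
Lemma csum_gt0_S k S (T : {set V}) y :
  S :\ y \subset T -> 0 < csum k.+1 S x -> 0 < csum k T x.
Proof.
move=> ST /csum_gt0P[A cA [kA AS]]; apply/csum_gt0P.
have [z zA yz] : exists2 z, z \in A & y \in A -> y = z.
  have [yA|_] := boolP (y \in A); first by exists y.
  by have /card_gt0P[z zA] : (0 < #|A|)%N by [rewrite kA]; exists z.
exists (A :\ z); first by apply: cliqueS cA; rewrite subD1set.
split; first by have := cardsD1 z A; rewrite zA kA => -[].
apply: subset_trans ST; apply/subsetP => w; rewrite !inE => /andP[wz wA].
rewrite (subsetP AS) // andbT; apply: contraNneq wz => e.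
by rewrite e -yz -?e.
Qed.

End Positive.

(** The weight after replacing [u] by the fraction or multiple [c] of its weight
added to [v]. The value at [u] itself is irrelevant, as [u] is then deleted
from the vertex set. *)
Definition pour x u v (c : R) : V -> R :=
  fun t => if t == v then x v + x u * c else x t.

Lemma pour_gt0 x u v c :
  (forall t, 0 < x t) -> 0 <= c -> forall t, 0 < pour x u v c t.
Proof.
move=> x0 c0 t; rewrite /pour; case: eqP => // _.
by rewrite ltr_wpDr ?x0 // mulr_ge0 // ltW.
Qed.

(** As [u] and [v] are not adjacent, the clique sum is affine in their two
weights jointly. *)
Lemma csum_pour k S x u v c : u \in S -> v \in S -> u != v -> ~~ adj G u v ->
  csum k.+1 (S :\ u) (pour x u v c) = csum k.+1 S x
    + x u * (c * csum k (S :&: nbh v) x - csum k (S :&: nbh u) x).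
Proof.
move=> uS vS uv nuv.
have vSu : v \in S :\ u by rewrite !inE eq_sym uv.
have nE : (S :\ u) :&: nbh v = S :&: nbh v.
  apply/setP => t; rewrite !inE; case: eqP => [->|//].
  by rewrite adj_sym (negPf nuv) !andbF.
rewrite (csumD1 _ _ uS) (csumD1 _ x vSu) (csumD1 _ _ vSu) nE /pour eqxx.
rewrite (@csum_ext _ (S :\ u :\ v) _ x); last first.
  by move=> t; rewrite !inE => /andP[/negPf-> _].
rewrite (@csum_ext _ (S :&: nbh v) _ x); last first.
  by move=> t; rewrite !inE; case: eqP => // ->; rewrite adj_irrefl andbF.
ring.
Qed.

(** The rate at which weight of [u] is exchanged for weight of [v] so that the
clique sum of order [k.+1] does not change. *)
Definition ratio k S x u v : R := csum k (S :&: nbh u) x / csum k (S :&: nbh v) x.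

Lemma csum_pour_ratio k S x u v :
    u \in S -> v \in S -> u != v -> ~~ adj G u v ->
    csum k (S :&: nbh v) x != 0 ->
  csum k.+1 (S :\ u) (pour x u v (ratio k S x u v)) = csum k.+1 S x.
Proof.
by move=> uS vS uv nuv v0; rewrite csum_pour // divfK // subrr mulr0 addr0.
Qed.

Lemma csum_clique_seq k (l : seq V) x : uniq l -> is_clique G [set i in l] ->
  csum k [set i in l] x = esym [seq x i | i <- l] k.
Proof.
elim: l k => [|u l IH] [|k]; rewrite ?csum0 ?esym0 //=.
  move=> _ _; rewrite /csum big_pred0 // => A; apply/negP => /andP[].
  rewrite inE => /andP[_ /eqP kA] /subset_leq_card.
  by rewrite kA set_nil cards0.
move=> /andP[ul ll]; rewrite set_cons cliqueU1 ?inE // => /andP[cl /setIidPl lu].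
rewrite (csumD1 _ _ (setU11 _ _)) setU1K ?inE // -!IH //.
by rewrite setIUl lu; have -> : [set u] :&: nbh u = set0; rewrite ?set0U //;
  apply/setP => t; rewrite !inE; case: eqP => // ->; rewrite adj_irrefl.
Qed.

Lemma csum_clique k S x : is_clique G S ->
  csum k S x = esym [seq x i | i <- enum S] k.
Proof.
by move=> cS; rewrite -{1}(set_enum S) csum_clique_seq ?enum_uniq ?set_enum.
Qed.

Section Inequality.
Variable w : nat.
Hypothesis clique_le : forall A, is_clique G A -> (#|A| <= w)%N.

Definition dens k S x := csum k S x / 'C(w, k)%:R.

(** Padding with zeros makes the normalisation that of [w] variables, whatever
the size of the clique. *)
Lemma dens_clique k S x : (k <= w)%N -> is_clique G S ->
  dens k S x = esym_mean ([seq x i | i <- enum S] ++ nseq (w - #|S|) 0) k.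
Proof.
move=> kw cS; rewrite /dens csum_clique // -(esym_cat0 _ (w - #|S|)) esym_meanE.
rewrite size_cat size_map -cardE size_nseq subnKC ?clique_le //.
by rewrite mulrC mulKf // pnatr_eq0 -lt0n bin_gt0.
Qed.

Lemma nonneg_clique S x : (forall v, 0 < x v) ->
  nonneg ([seq x i | i <- enum S] ++ nseq (w - #|S|) 0).
Proof.
move=> x0 y; rewrite mem_cat => /orP[/mapP[i _ ->]|]; first exact: ltW.
by rewrite mem_nseq => /andP[_ /eqP->].
Qed.

Lemma dens_ge0 k S x : (forall v, 0 < x v) -> 0 <= dens k S x.
Proof. by move=> x0; rewrite divr_ge0 ?csum_ge0. Qed.

Lemma dens_gt0 k S x : (k <= w)%N -> (0 < dens k S x) = (0 < csum k S x).
Proof. by move=> kw; rewrite pmulr_lgt0 // invr_gt0 ltr0n bin_gt0. Qed.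

(** Induction on the number of vertices. In a set that is not a clique, a vertex
can be deleted, with a transfer of its weight to a non-neighbour, without
changing the density on the right or decreasing the one on the left. A vertex
that lies in no clique of the lower order lies in none of the higher order
and is simply dropped. *)
Lemma dens_maclaurin k S x : (k.+1 < w)%N -> (forall v, 0 < x v) ->
  dens k.+2 S x ^+ k.+1 <= dens k.+1 S x ^+ k.+2.
Proof.
move=> kw; have [n] := ubnP #|S|; elim: n S x => // n IH S x nS x0.
have [cS|] := boolP (is_clique G S).
  rewrite !dens_clique // 1?ltnW //; apply: maclaurin; exact: nonneg_clique.
move=> /forall_inPn[u uS /forall_inPn[v vS]]; rewrite negb_imply => /andP[uv nuv].
(* It is enough to find a weighting of [S :\ y] with the same lower clique
sum and at least the same higher one. *)
have reduce y z : y \in S -> (forall t, 0 < z t) ->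
    csum k.+1 (S :\ y) z = csum k.+1 S x ->
    csum k.+2 S x <= csum k.+2 (S :\ y) z ->
  dens k.+2 S x ^+ k.+1 <= dens k.+1 S x ^+ k.+2.
  move=> yS z0 e1 e2; rewrite [X in _ <= X ^+ _]/dens -e1 -/(dens k.+1 (S :\ y) z).
  apply: le_trans (IH _ _ _ z0); last first.
    by move: nS; rewrite (cardsD1 y S) yS.
  by rewrite lerXn2r ?nnegrE ?dens_ge0 // ler_wpM2r // invr_ge0.
(* A vertex whose derivative vanishes contributes to neither clique sum. *)
have drop t : t \in S -> csum k (S :&: nbh t) x = 0 ->
    dens k.+2 S x ^+ k.+1 <= dens k.+1 S x ^+ k.+2.
  move=> tS e; have e' : csum k.+1 (S :&: nbh t) x = 0.
    apply/eqP/negPn/negP => h.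
    have hp : 0 < csum k.+1 (S :&: nbh t) x by rewrite lt_def h csum_ge0.
    by have := csum_gt0_S x0 (subD1set _ t) hp; rewrite e ltxx.
  apply: (reduce t x) => //; rewrite [csum _ S x](csumD1 _ x tS).
    by rewrite e mulr0 addr0.
  by rewrite e' mulr0 addr0.
have [/(drop u uS)//|u0] := eqVneq (csum k (S :&: nbh u) x) 0.
have [/(drop v vS)//|v0] := eqVneq (csum k (S :&: nbh v) x) 0.
(* The last premise says that moving the weight of [a] to [b] does not
decrease the higher clique sum. *)
have merge a b : a \in S -> b \in S -> a != b -> ~~ adj G a b ->
    csum k (S :&: nbh b) x != 0 ->
    csum k.+1 (S :&: nbh a) x * csum k (S :&: nbh b) x <=
    csum k.+1 (S :&: nbh b) x * csum k (S :&: nbh a) x ->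
    dens k.+2 S x ^+ k.+1 <= dens k.+1 S x ^+ k.+2.
  move=> aS bS ab nab b0 h; apply: (reduce a (pour x a b (ratio k S x a b))) => //.
  - by apply: pour_gt0 => //; rewrite divr_ge0 ?csum_ge0.
  - exact: csum_pour_ratio.
  rewrite csum_pour // lerDl; apply: mulr_ge0; first exact: ltW.
  rewrite subr_ge0 /ratio mulrAC.
  by rewrite ler_pdivlMr ?lt_def ?b0 ?csum_ge0 // [X in _ <= X]mulrC.
have [h|/ltW h] := lerP
    (csum k.+1 (S :&: nbh u) x * csum k (S :&: nbh v) x)
    (csum k.+1 (S :&: nbh v) x * csum k (S :&: nbh u) x).
  exact: (merge u v).
by apply: (merge v u); rewrite // 1?eq_sym // adj_sym.
Qed.

Lemma csum_gt0_ext k S x y : (forall v, 0 < x v) -> (forall v, 0 < y v) ->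
  0 < csum k S x -> 0 < csum k S y.
Proof. by move=> x0 y0 /(csum_gt0P x0) h; apply/(csum_gt0P y0). Qed.

Definition tight k S x := dens k.+2 S x ^+ k.+1 = dens k.+1 S x ^+ k.+2.

(** Each [v] lies in a clique of order [k.+1] inside [S], said by the positivity
of the derivative, by which the transfers of weight divide. *)
Definition covered k S x := {in S, forall v, 0 < csum k (S :&: nbh v) x}.

(** A clique with fewer than [w] vertices would put a zero into the padded list,
whose entries must all be equal by [maclaurin_eq]. *)
Lemma tight_clique k S x : (k.+1 < w)%N -> (forall v, 0 < x v) ->
    is_clique G S -> 0 < csum k.+1 S x -> tight k S x ->
  #|S| = w /\ {in S &, forall u v, x u = x v}.
Proof.
move=> kw x0 cS Sp; rewrite /tight !dens_clique // 1?ltnW // => e.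
have := maclaurin_eq (nonneg_clique x0) _ e.
rewrite -dens_clique 1?ltnW // dens_gt0 1?ltnW // => /(_ Sp).
set m := esym_mean _ _ => h.
have xm v : v \in S -> x v = m.
  by move=> vS; apply: h; rewrite mem_cat map_f ?mem_enum.
split=> [|u v uS vS]; last by rewrite !xm.
have /(csum_gt0P x0)[A _ [kA AS]] := Sp.
have /card_gt0P[v vA] : (0 < #|A|)%N by rewrite kA.
have vS := subsetP AS v vA.
apply/eqP; rewrite eqn_leq clique_le //= leqNgt; apply/negP => Sw.
have : 0 = m by apply: h; rewrite mem_cat mem_nseq subn_gt0 Sw eqxx orbT.
by move=> m0; have := x0 v; rewrite xm // -m0 ltxx.
Qed.

Lemma csum_covered_gt0 k S x v : (forall t, 0 < x t) -> v \in S ->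
  0 < csum k (S :&: nbh v) x -> 0 < csum k.+1 S x.
Proof.
by move=> x0 vS h; rewrite (csumD1 _ _ vS) ltr_wpDl ?csum_ge0 ?mulr_gt0.
Qed.

(** Otherwise moving the weight of [u] to [v] would give a violation of
[dens_maclaurin]. *)
Lemma tight_slope_le k S x u v : (k.+1 < w)%N -> (forall t, 0 < x t) ->
    tight k S x -> covered k S x ->
    u \in S -> v \in S -> u != v -> ~~ adj G u v ->
  csum k.+1 (S :&: nbh v) x * csum k (S :&: nbh u) x <=
  csum k.+1 (S :&: nbh u) x * csum k (S :&: nbh v) x.
Proof.
move=> kw x0 tS cS uS vS uv nuv; rewrite leNgt; apply/negP => h.
have vp := cS v vS; set y := pour x u v (ratio k S x u v).
have y0 t : 0 < y t by apply: pour_gt0 => //; rewrite divr_ge0 ?csum_ge0.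
have := dens_maclaurin (S :\ u) kw y0; apply/negP; rewrite -ltNge.
rewrite {1}/dens csum_pour_ratio // ?gt_eqF // -/(dens k.+1 S x) -tS.
rewrite ltrXn2r ?nnegrE ?dens_ge0 // ltr_pM2r ?invr_gt0 ?ltr0n ?bin_gt0 //.
rewrite csum_pour // ltrDl mulr_gt0 // subr_gt0 /ratio mulrAC.
by rewrite ltr_pdivlMr // [ltRHS]mulrC.
Qed.

Lemma tight_pour k S x u v : (k.+1 < w)%N -> (forall t, 0 < x t) ->
    tight k S x -> covered k S x ->
    u \in S -> v \in S -> u != v -> ~~ adj G u v ->
  tight k (S :\ u) (pour x u v (ratio k S x u v)).
Proof.
move=> kw x0 tS cS uS vS uv nuv; have vp := cS v vS.
rewrite /tight /dens csum_pour_ratio ?gt_eqF // csum_pour //.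
suff -> : ratio k S x u v * csum k.+1 (S :&: nbh v) x = csum k.+1 (S :&: nbh u) x.
  by rewrite subrr mulr0 addr0.
apply: (mulIf (lt0r_neq0 vp)); rewrite mulrAC divfK ?gt_eqF // mulrC.
apply/le_anti; rewrite !tight_slope_le // 1?eq_sym //.
by rewrite adj_sym.
Qed.

(** If [v] were in cliques of the lower order only, deleting it would decrease
only the right-hand density, against [dens_maclaurin]. *)
Lemma tight_slope_gt0 k S x v : (k.+1 < w)%N -> (forall t, 0 < x t) ->
    tight k S x -> v \in S -> 0 < csum k (S :&: nbh v) x ->
  0 < csum k.+1 (S :&: nbh v) x.
Proof.
move=> kw x0 tS vS vp; rewrite lt_def csum_ge0 // andbT; apply/eqP => e.
have := dens_maclaurin (S :\ v) kw x0; apply/negP; rewrite -ltNge.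
have -> : dens k.+2 (S :\ v) x = dens k.+2 S x.
  by rewrite /dens (csumD1 _ x vS) e mulr0 addr0.
rewrite tS ltrXn2r ?nnegrE ?dens_ge0 // ltr_pM2r; last first.
  by rewrite invr_gt0 ltr0n bin_gt0 ltnW.
by rewrite (csumD1 _ x vS) ltrDl mulr_gt0.
Qed.

(** A vertex [t] lies in a clique of order [k.+2] by [tight_slope_gt0]; removing
[u] from it, or any other vertex if it does not contain [u], leaves a clique
of order [k.+1] through [t]. *)
Lemma covered_pour k S x y u : (k.+1 < w)%N -> (forall t, 0 < x t) ->
    (forall t, 0 < y t) -> tight k S x -> covered k S x ->
  covered k (S :\ u) y.
Proof.
move=> kw x0 y0 tS cS t; rewrite inE => /andP[_ tinS].
apply: (csum_gt0_ext x0 y0).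
apply: (csum_gt0_S x0 (S := S :&: nbh t) (y := u)).
  by rewrite setIDAC.
by apply: tight_slope_gt0 => //; apply: cS.
Qed.

(** A vertex outside a bad triple [u, v, t] that has a non-neighbour can be
deleted by [tight_pour], and induction applies. If there is none, [S :\ v] is
a clique, to which the weight of [v] can be moved in two ways; comparing the
weights of [u] and [t] in the two resulting constant weightings is
contradictory. *)
Lemma tight_nonadj_trans k S x : (k.+1 < w)%N -> (forall t, 0 < x t) ->
    tight k S x -> covered k S x ->
  {in S & &, forall u v t, ~~ adj G u v -> ~~ adj G v t -> ~~ adj G u t}.
Proof.
move=> kw; have [n] := ubnP #|S|; elim: n S x => // n IH S x nS x0 tS cS.
move=> u v t uS vS tinS nuv nvt; apply/negP => ut.
have uv : u != v by apply: contraNneq nvt => <-.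
have vt : v != t by apply: contraNneq nuv => ->.
have r0 a b s : 0 < pour x a b (ratio k S x a b) s.
  by apply: pour_gt0 => //; rewrite divr_ge0 ?csum_ge0.
have [/existsP[y /existsP[z /and5P[yS zS yz nyz yuvt]]]|no] := boolP
    [exists y, exists z, [&& y \in S, z \in S, y != z, ~~ adj G y z
       & y \notin [:: u; v; t]]].
  have inSy a : a \in S -> a \in [:: u; v; t] -> a \in S :\ y.
    move=> aS ain; rewrite !inE aS andbT; apply: contraNneq yuvt => <-; exact: ain.
  have := IH (S :\ y) _ _ (r0 y z) (tight_pour kw x0 tS cS yS zS yz nyz)
    (covered_pour kw x0 (r0 y z) tS cS) u v t.
  rewrite ut => h.
  suff: ~~ true by [].
  apply: h; rewrite ?inSy // ?inE ?eqxx ?orbT //.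
  by move: nS; rewrite (cardsD1 y S) yS.
have bad y z : y \in S -> z \in S -> y != z -> ~~ adj G y z -> y \in [:: u; v; t].
  move=> yS zS yz nyz; apply: contraNT no => h.
  by apply/existsP; exists y; apply/existsP; exists z; apply/and5P.
have clq : is_clique G (S :\ v).
  apply/cliqueP => p q; rewrite !inE => /andP[pv pS] /andP[qv qS] pq.
  apply: contraT => npq; have pin := bad p q pS qS pq npq.
  have qin : q \in [:: u; v; t] by apply: (bad q p); rewrite // 1?eq_sym // adj_sym.
  move: pin qin npq pq; rewrite !inE (negPf pv) (negPf qv) /=.
  move=> /orP[]/eqP-> /orP[]/eqP->; rewrite ?eqxx ?ut //.
  by rewrite adj_sym ut.
(* After moving the weight of [v] to [a], the weight of [a] has increased to
that of [b]. *)
have lt_x a b : a \in S -> b \in S -> v != a -> v != b -> a != b -> ~~ adj G v a ->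
    x a < x b.
  move=> aS bS va vb ab nva.
  have Sp : 0 < csum k.+1 (S :\ v) (pour x v a (ratio k S x v a)).
    rewrite csum_pour_ratio ?gt_eqF ?cS //.
    by apply: (csum_covered_gt0 x0 vS); apply: cS.
  have [_ h] := tight_clique kw (r0 v a) clq Sp
    (tight_pour kw x0 tS cS vS aS va nva).
  have := h b a; rewrite !inE eq_sym vb bS eq_sym va aS => /(_ isT isT).
  rewrite /pour eqxx eq_sym (negPf ab) => ->.
  by rewrite ltrDl mulr_gt0 // divr_gt0 ?cS.
have ut' : u != t by apply: contraTneq ut => ->; rewrite adj_irrefl.
have := lt_x u t uS tinS; rewrite eq_sym uv vt ut' adj_sym nuv
  => /(_ isT isT isT isT) h1.
have := lt_x t u tinS uS; rewrite vt eq_sym uv eq_sym ut' nvt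
  => /(_ isT isT isT isT) h2.
by have := lt_trans h1 h2; rewrite ltxx.
Qed.

Lemma exists_subset_card k A : (k <= #|A|)%N ->
  exists2 B : {set V}, B \subset A & #|B| = k.
Proof.
move=> kA; have : (0 < #|[set B : {set V} | B \subset A & #|B| == k]|)%N.
  by rewrite cards_draws bin_gt0.
by case/card_gt0P => B; rewrite inE => /andP[BA /eqP kB]; exists B.
Qed.

Lemma csum_gt0_clique k S x A : (forall v, 0 < x v) ->
  is_clique G A -> A \subset S -> (k <= #|A|)%N -> 0 < csum k S x.
Proof.
move=> x0 cA AS /exists_subset_card[B BA kB]; apply/(csum_gt0P x0).
exists B; first exact: cliqueS BA cA.
by split=> //; apply: subset_trans AS.
Qed.

(** On a set where non-adjacency is transitive, the [y] non-adjacent to [t],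
among them [t] itself, form the class of [t]. *)
Definition class_sum S x t : R := \sum_(y in S | ~~ adj G y t) x y.

Definition nonadj_trans S :=
  {in S & &, forall u v t, ~~ adj G u v -> ~~ adj G v t -> ~~ adj G u t}.

Lemma tight_complete_clique k S x : (k.+1 < w)%N -> (forall v, 0 < x v) ->
    is_clique G S -> #|S| = w ->
  tight k S x <-> {in S &, forall u v, x u = x v}.
Proof.
move=> kw x0 cS Sw; split=> [tS|xE].
  have [] // := tight_clique kw x0 cS _ tS.
  by apply: (csum_gt0_clique x0 cS) => //; rewrite Sw ltnW.
have [c xc] : exists c, {in S, forall v, x v = c}.
  have [->|[u uS]] := set_0Vmem S; first by exists 0 => v; rewrite inE.
  by exists (x u) => v vS; apply: xE.
have dE j : (j <= w)%N -> dens j S x = c ^+ j.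
  move=> jw; rewrite dens_clique // Sw subnn cats0.
  suff -> : [seq x i | i <- enum S] = nseq w c by rewrite esym_mean_nseq.
  rewrite -{1}Sw cardE; have : {subset enum S <= S} by move=> v; rewrite mem_enum.
  elim: (enum S) => //= v l IH h; rewrite xc ?h ?mem_head // IH // => a al.
  by apply: h; rewrite inE al orbT.
by rewrite /tight (dE _ kw) (dE _ (ltnW kw)) -!exprM mulnC.
Qed.

(** Vertices of one class have the same neighbours, so pouring one into another at
rate 1 changes neither clique sums nor class sums; this ends with a clique,
where class sums are weights. *)
Lemma tight_multipartite k S x A : (k.+1 < w)%N -> (forall v, 0 < x v) ->
    nonadj_trans S -> is_clique G A -> A \subset S -> #|A| = w ->
  tight k S x <-> {in S &, forall u v, class_sum S x u = class_sum S x v}.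
Proof.
move=> kw; have [n] := ubnP #|S|; elim: n S x A => // n IH S x A nS x0 tr cA AS Aw.
have [cS|] := boolP (is_clique G S).
  have Sw : #|S| = w.
    by apply/eqP; rewrite eqn_leq clique_le //= -Aw subset_leq_card.
  have sE t : t \in S -> class_sum S x t = x t.
    move=> tinS; rewrite /class_sum (big_pred1 t) // => y /=.
    apply/andP/eqP => [[yS]|->]; last by rewrite adj_irrefl.
    by apply: contraNeq => yt; apply: (elimT (cliqueP S) cS).
  rewrite tight_complete_clique //; split=> h u v uS vS.
    by rewrite !sE //; apply: h.
  by rewrite -!sE //; apply: h.
move=> /forall_inPn[u uS /forall_inPn[v vS]]; rewrite negb_imply => /andP[uv nuv].
have sym a b : adj G a b = adj G b a by rewrite adj_sym.
have nE t : t \in S -> adj G u t = adj G v t.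
  move=> tinS; apply/idP/idP; apply: contraTT => h.
    by apply: (tr u v t).
  by apply: (tr v u t) => //; rewrite adj_sym.
have NE : S :&: nbh u = S :&: nbh v.
  by apply/setP => t; rewrite !inE; case: (boolP (t \in S)) => //= /nE.
set y := pour x u v 1; have y0 t : 0 < y t by apply: pour_gt0.
have cE j : csum j.+1 (S :\ u) y = csum j.+1 S x.
  by rewrite csum_pour // NE mul1r subrr mulr0 addr0.
have vSu : v \in S :\ u by rewrite !inE eq_sym uv.
have sE t : t \in S -> class_sum (S :\ u) y t = class_sum S x t.
  move=> tinS; rewrite /class_sum.
  have [vt|nvt] := boolP (adj G v t).
    apply: eq_big => [a|a /andP[_]].
      rewrite !inE; case: eqP => //= ->.
      by rewrite nE // vt andbF.
    by rewrite /y /pour; case: eqP => // ->; rewrite vt.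
  rewrite (bigD1 v) /=; last by rewrite vSu.
  rewrite [RHS](bigD1 u) /=; last by rewrite uS nE.
  rewrite [in RHS](bigD1 v) /=; last by rewrite vS nvt eq_sym.
  rewrite {1}/y /pour eqxx mulr1 addrA [x v + _]addrC; congr (_ + _).
  apply: eq_big => [a|a].
    by rewrite !inE; case: (a == u); rewrite ?andbT ?andbF.
  by move=> /andP[_ /negPf av]; rewrite /y /pour av.
have -> : tight k S x <-> tight k (S :\ u) y by rewrite /tight /dens !cE.
have trSu : nonadj_trans (S :\ u).
  by move=> a b c /setD1P[_ aS] /setD1P[_ bS] /setD1P[_ cS]; apply: tr.
have [B [cB BS Bw]] : exists B, [/\ is_clique G B, B \subset S :\ u & #|B| = w].
  have [uA|uA] := boolP (u \in A); last by exists A; rewrite subsetD1 AS.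
  have vA : v \notin A.
    by apply: contra nuv => vA; apply: (elimT (cliqueP A) cA).
  have vAu : v \notin A :\ u by rewrite inE (negPf vA) andbF.
  exists (v |: (A :\ u)); split.
  - rewrite cliqueU1 // (cliqueS (subD1set A u) cA) /=.
    apply/subsetP => t /setD1P[tu tA]; rewrite inE -nE ?(subsetP AS) //.
    by apply: (elimT (cliqueP A) cA) => //; rewrite eq_sym.
  - by rewrite subUset sub1set vSu setSD.
  - by rewrite cardsU1 vAu -Aw (cardsD1 u A) uA.
rewrite (IH (S :\ u) y B) //; last by move: nS; rewrite (cardsD1 u S) uS.
have uvE : class_sum S x u = class_sum S x v.
  apply: eq_bigl => a; case: (boolP (a \in S)) => //= aS.
  by rewrite sym nE // sym.
split=> h a b aS bS; last first.
  by move: aS bS => /setD1P[_ aS] /setD1P[_ bS]; rewrite !sE //; apply: h.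
have hv a' : a' \in S -> class_sum S x a' = class_sum S x v.
  move=> a'S; have [->//|a'u] := eqVneq a' u.
  by rewrite -!sE //; apply: h; rewrite // !inE a'u.
by rewrite !hv.
Qed.

End Inequality.
End CliqueSums.

(** * Complete multipartite structure and partitions *)

Section Partitions.
Set Implicit Arguments.
Unset Strict Implicit.
Variables (V : finType) (G : sgraph V) (S : {set V}).
Let T := {v : V | v \in S}.

Lemma multipartite_pblock j (P : {set {set T}}) :
  multipartite_classes (induced G S) j P ->
  forall a b, (b \in pblock P a) = ~~ adj G (val a) (val b).
Proof.
move=> [/and3P[/eqP cP tP _] _ h] a b.
rewrite -eq_pblock ?cP ?inE //; apply/eqP/idP => [e|nab].
  by apply/negP => /(h a b).
by apply/eqP; apply: contraNT nab => /eqP /(h a b).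
Qed.

Lemma multipartite_nonadj_trans j (P : {set {set T}}) :
  multipartite_classes (induced G S) j P -> nonadj_trans G S.
Proof.
move=> mP u v t uS vS tS; have [/and3P[/eqP cP tP _] _ _] := mP.
have inP (a : T) : a \in cover P by rewrite cP inE.
have nE (a b : T) : ~~ adj G (val a) (val b) = (pblock P a == pblock P b).
  by rewrite eq_pblock // (multipartite_pblock mP).
have := nE (Sub u uS) (Sub v vS); have := nE (Sub v vS) (Sub t tS).
have := nE (Sub u uS) (Sub t tS); rewrite !SubK => -> -> ->.
by move=> /eqP-> /eqP->.
Qed.

Lemma multipartite_class_sum (R : realFieldType) (x : V -> R) j
    (P : {set {set T}}) B b :
    multipartite_classes (induced G S) j P -> B \in P -> b \in B ->
  \sum_(v in B) x (val v) = class_sum G S x (val b).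
Proof.
move=> mP BP bB; have [/and3P[_ tP _] _ _] := mP.
rewrite /class_sum -(def_pblock tP BP bB).
rewrite (reindex_onto (val : T -> V) (insubd b)) /=; last first.
  by move=> y /andP[yS _]; rewrite insubdK.
apply: eq_bigl => a; rewrite (multipartite_pblock mP) adj_sym valKd eqxx andbT.
by rewrite (valP a).
Qed.

(** The classes of non-adjacency; a transversal is a clique, and a maximum clique
meets each class at most once, so their number is the clique number. *)
Lemma nonadj_trans_multipartite A : nonadj_trans G S ->
    is_clique G A -> A \subset S ->
    (forall B, is_clique G B -> (#|B| <= #|A|)%N) ->
  complete_multipartite (induced G S) #|A|.
Proof.
move=> tr cA AS maxA; pose r := fun a b : T => ~~ adj G (val a) (val b).
have eqr : {in [set: T] & &, equivalence_rel r}.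
  move=> a b c _ _ _; rewrite /r adj_irrefl; split=> // nab.
  apply/idP/idP; apply: tr; rewrite ?(valP a) ?(valP b) ?(valP c) //.
  by rewrite adj_sym.
pose P := equivalence_partition r [set: T].
have pP : partition P [set: T] := equivalence_partitionP eqr.
have [/eqP cP tP P0] := and3P pP.
have inP a : a \in cover P by rewrite cP inE.
have rE a b : (pblock P a == pblock P b) = r a b.
  by rewrite eq_pblock // (pblock_equivalence_partition eqr) ?inE.
exists P; split=> //; last first.
  move=> a b; split=> [ab|]; last by move/eqP; rewrite rE negbK.
  by apply/eqP; rewrite rE negbK.
apply/eqP; rewrite eqn_leq; apply/andP; split.
  have trX := transversalP pP; set X := transversal P _ in trX.
  rewrite -(card_transversal trX) -(card_imset _ val_inj) maxA //.
  apply/cliqueP => _ _ /imsetP[a aX ->] /imsetP[b bX ->] ab.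
  apply: contraNT ab => nab; apply/eqP; congr val.
  apply: (pblock_inj trX) => //; apply/eqP; by rewrite rE.
pose A' := [set a : T | val a \in A].
have -> : #|A| = #|A'|.
  rewrite -(card_imset A' val_inj); congr #|pred_of_set _|.
  apply/setP => v; apply/idP/imsetP => [vA|[a]]; last by rewrite inE => ? ->.
  by exists (Sub v (subsetP AS v vA)); rewrite ?inE SubK.
rewrite -(card_in_imset (f := pblock P) (D := A')); last first.
  move=> a b; rewrite !inE => aA bA /eqP; rewrite rE => nab.
  apply/eqP; rewrite -val_eqE; apply: contraNT nab.
  exact: (elimT (cliqueP G A) cA).
by apply/subset_leq_card/subsetP => _ /imsetP[a _ ->]; apply: pblock_mem.
Qed.

End Partitions.

(** * Restriction to the vertices of cliques *)

Section CliqueVertices.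
Set Implicit Arguments.
Unset Strict Implicit.
Variables (V : finType) (G : sgraph V).

Lemma clique_number_ge A : is_clique G A -> (#|A| <= clique_number G)%N.
Proof. by move=> cA; apply: (leq_bigmax_cond (F := fun A : {set V} => #|A|)). Qed.

Lemma max_clique_exists : exists2 A, is_clique G A & #|A| = clique_number G.
Proof.
have c0 : is_clique G set0 by apply/cliqueP => u v; rewrite inE.
have [|A cA e] := @eq_bigmax_cond _ [pred A : {set V} | is_clique G A]
    (fun A : {set V} => #|A|).
  by apply/card_gt0P; exists set0.
by exists A.
Qed.

Lemma sub_clique_vertices k A : is_clique G A -> (k < #|A|)%N ->
  A \subset clique_vertices G k.+1.
Proof.
move=> cA kA; apply/subsetP => v vA; rewrite inE.
have [|B BA kB] := @exists_subset_card _ k (A :\ v).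
  by move: kA; rewrite (cardsD1 v) vA.
have vB : v \notin B by apply/negP => /(subsetP BA); rewrite !inE eqxx.
apply/existsP; exists (v |: B); rewrite setU11 andbT inE cardsU1 vB kB eqxx andbT.
apply: cliqueS cA; rewrite subUset sub1set vA.
by apply: subset_trans BA _; rewrite subD1set.
Qed.

Variables (R : realFieldType) (x : V -> R).

Lemma csum_clique_vertices k j : (k < j)%N ->
  csum G j (clique_vertices G k.+1) x = csum G j [set: V] x.
Proof.
move=> kj; apply: eq_bigl => A; rewrite subsetT andbT.
apply: andb_idr; rewrite inE => /andP[cA /eqP jA].
by apply: sub_clique_vertices; rewrite ?jA.
Qed.

Lemma covered_clique_vertices k : (forall v, 0 < x v) ->
  covered G k (clique_vertices G k.+1) x.
Proof.
move=> x0 v; rewrite inE => /existsP[A /andP[]].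
rewrite inE => /andP[cA /eqP kA] vA; apply/(csum_gt0P _ x0).
exists (A :\ v); first by apply: cliqueS cA; rewrite subD1set.
split; first by have := cardsD1 v A; rewrite vA kA => -[].
have AS : A \subset clique_vertices G k.+1.
  by apply: sub_clique_vertices; rewrite ?kA.
apply/subsetP => t /setD1P[tv tA]; rewrite inE (subsetP AS) // inE.
by apply: (elimT (cliqueP G A) cA) => //; rewrite eq_sym.
Qed.

End CliqueVertices.

Lemma root_eq_root (R : realType) (a b : R) (p q : nat) :
  0 <= a -> 0 <= b -> (0 < p)%N -> (0 < q)%N ->
  a `^ (p%:R^-1) = b `^ (q%:R^-1) <-> a ^+ q = b ^+ p.
Proof.
move=> a0 b0 p0 q0.
have pow (c : R) m k : 0 <= c -> (0 < m)%N -> (c `^ (m%:R^-1)) ^+ (m * k) = c ^+ k.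
  move=> c0 m0; rewrite exprM; congr (_ ^+ k).
  rewrite -powR_mulrn ?powR_ge0 // -powRrM mulVf ?powRr1 //.
  by rewrite pnatr_eq0 -lt0n.
split=> [e|e]; first by rewrite -(pow a p q) // -(pow b q p) // e mulnC.
apply: (@pexpIrn _ (p * q)%N); rewrite ?muln_gt0 ?p0 ?nnegrE ?powR_ge0 //.
by rewrite pow // mulnC pow.
Qed.

Theorem theorem3 (R : realType) (n : nat) (hn : (1 <= n)%N)
    (G : sgraph 'I_n) (s : nat) (hs1 : (1 <= s)%N)
    (hs : (s < clique_number G)%N)
    (x : 'rV[R]_n) (hx : forall i : 'I_n, 0 < x ord0 i) :
  clique_density G s.+1 x `^ (s.+1%:R^-1) = clique_density G s x `^ (s%:R^-1)
  <->
  complete_multipartite (induced G (clique_vertices G s)) (clique_number G) /\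
  (forall P : {set {set {v : 'I_n | v \in clique_vertices G s}}},
     multipartite_classes (induced G (clique_vertices G s))
       (clique_number G) P ->
     forall A B : {set {v : 'I_n | v \in clique_vertices G s}},
       A \in P -> B \in P ->
       \sum_(v in A) x ord0 (val v) = \sum_(v in B) x ord0 (val v)).
Proof.
case: s hs1 hs => // k _ kw; set S := clique_vertices G k.+1.
pose X i := x ord0 i; pose w := clique_number G.
have dE j : (k < j)%N -> clique_density G j x = dens G w j S X.
  move=> kj; rewrite /clique_density /dens csum_clique_vertices //; congr (_ / _).
  by apply: eq_bigl => A; rewrite subsetT andbT.
have [A cA Aw] := max_clique_exists G.
have AS : A \subset S by apply: sub_clique_vertices; rewrite // Aw ltnW.
have cle := @clique_number_ge _ G.
rewrite !dE // root_eq_root ?dens_ge0 // -/(tight G w k S X).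
have tightP := fun tr => @tight_multipartite R _ G w cle k S X A kw hx tr cA AS Aw.
split=> [tS|[[P mP] sumP]].
  have tr := tight_nonadj_trans cle kw hx tS (covered_clique_vertices hx).
  split.
    rewrite -Aw; apply: nonadj_trans_multipartite => // B cB.
    by rewrite Aw cle.
  move=> P mP B C BP CP; have [/and3P[_ _ P0] _ _] := mP.
  have nonempty D : D \in P -> exists d, d \in D.
    by move=> DP; apply/set0Pn; apply: contraNneq P0 => <-.
  have [[b bB] [c cC]] := (nonempty B BP, nonempty C CP).
  rewrite !(multipartite_class_sum X mP BP bB) (multipartite_class_sum X mP CP cC).
  by apply: (proj1 (tightP tr) tS); apply: valP.
apply: (proj2 (tightP (multipartite_nonadj_trans mP))) => u v uS vS.
have [/and3P[/eqP cP tP _] _ _] := mP.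
have inP a : pblock P a \in P by rewrite pblock_mem // cP inE.
have sE t (tS : t \in S) : class_sum G S X t =
    \sum_(a in pblock P (Sub t tS)) x ord0 (val a).
  rewrite (multipartite_class_sum X mP (inP (Sub t tS)) (b := Sub t tS)) ?SubK //.
  by rewrite mem_pblock cP inE.
by rewrite (sE u uS) (sE v vS); apply: (sumP P mP).
Qed.
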